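(* Let $a,b,c>0$ with $a>b$, and let $M_0$ be the ellipsoid $\frac{x^2}{a}+\frac{y^2}{b}+\frac{z^2}{c}=1$ in $\mathbb{R}^3$ with the metric induced from the Minkowski metric $dx^2+dy^2-dz^2$. The Gauss curvature $K$ of $M_0$ with the induced metric (at points where this metric is non-degenerate) is negative, and is given by the formula $$\frac1K=-abc\left(\frac{x^2}{a^2}+\frac{y^2}{b^2}-\frac{z^2}{c^2}\right)^2 .$$
   Context: The induced metric is degenerate exactly along the two curves on $M_0$ where $\frac{x^2}{a^2}+\frac{y^2}{b^2}-\frac{z^2}{c^2}=0$ (the tropics), Lorentzian where this expression is positive and Riemannian where it is negative. The Gauss curvature of a (pseudo-)Riemannian surface is its sectional curvature $K=\frac{\langle R(X,Y)Y,X\rangle}{\langle X,X\rangle\langle Y,Y\rangle-\langle X,Y\rangle^2}$ for any basis $X,Y$ of the tangent plane, with the sign convention for $R$ under which round spheres in Euclidean space have $K>0$. *)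

(* Defs.v *)
From Stdlib Require Import Reals.
From Coquelicot Require Import Coquelicot.

Open Scope R_scope.

Definition R2 : Type := (R * R)%type.
Definition R3 : Type := (R * R * R)%type.

Definition cx (p : R3) : R := fst (fst p).
Definition cy (p : R3) : R := snd (fst p).
Definition cz (p : R3) : R := snd p.

Definition minkowski (v w : R3) : R :=
  cx v * cx w + cy v * cy w - cz v * cz w.

(* The semi-axes are the square roots of a, b, c. *)
Definition ellipsoid (a b c : R) (p : R3) : Prop :=
  cx p ^ 2 / a + cy p ^ 2 / b + cz p ^ 2 / c = 1.

Inductive idx : Set := I1 | I2.

Definition sum_idx (f : idx -> R) : R := f I1 + f I2.

Definition coord (i : idx) (X : R2) : R :=
  match i with I1 => fst X | I2 => snd X end.

Definition partial (i : idx) (f : R2 -> R) (u : R2) : R :=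
  match i with
  | I1 => Derive (fun t => f (t, snd u)) (fst u)
  | I2 => Derive (fun t => f (fst u, t)) (snd u)
  end.

(* On an open set U this is C^infinity: [ex_diff_n f n] asks for existence and
   continuity of all iterated partial derivatives of order at most n. *)
Definition smooth_on (U : R2 -> Prop) (f : R2 -> R) : Prop :=
  forall u, U u -> forall n : nat,
    ex_diff_n (fun s t => f (s, t)) n (fst u) (snd u).

Definition partial3 (i : idx) (r : R2 -> R3) (u : R2) : R3 :=
  (partial i (fun w => cx (r w)) u,
   partial i (fun w => cy (r w)) u,
   partial i (fun w => cz (r w)) u).

Definition differential (r : R2 -> R3) (u X : R2) : R3 :=
  (sum_idx (fun i => coord i X * cx (partial3 i r u)),
   sum_idx (fun i => coord i X * cy (partial3 i r u)),
   sum_idx (fun i => coord i X * cz (partial3 i r u))).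

(* A local parametrization r : U -> M of a regular surface M in R^3: a smooth
   immersion that is a homeomorphism of the open set U onto a relatively open
   subset of M.  The last two fields are injectivity and openness of
   r : U -> M; continuity of r follows from smoothness. *)
Record local_param (M : R3 -> Prop) (U : R2 -> Prop) (r : R2 -> R3) : Prop := {
  lp_open : open U;
  lp_maps : forall u, U u -> M (r u);
  lp_smooth_x : smooth_on U (fun u => cx (r u));
  lp_smooth_y : smooth_on U (fun u => cy (r u));
  lp_smooth_z : smooth_on U (fun u => cz (r u));
  lp_immersion : forall u X, U u -> differential r u X = (0, 0, 0) -> X = (0, 0);
  lp_injective : forall u v, U u -> U v -> r u = r v -> u = v;
  lp_open_map : forall V : R2 -> Prop, open V -> (forall u, V u -> U u) ->
    exists W : R3 -> Prop, open W /\
      forall m, (M m /\ W m) <-> (exists u, V u /\ r u = m)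
}.

Definition tangent (M : R3 -> Prop) (p v : R3) : Prop :=
  exists (U : R2 -> Prop) (r : R2 -> R3) (u X : R2),
    local_param M U r /\ U u /\ r u = p /\ v = differential r u X.

Definition nondegenerate_at (M : R3 -> Prop) (p : R3) : Prop :=
  forall v, tangent M p v ->
    (forall w, tangent M p w -> minkowski v w = 0) -> v = (0, 0, 0).

Definition metric : Type := idx -> idx -> R2 -> R.

Definition induced_metric (r : R2 -> R3) : metric :=
  fun i j u => minkowski (partial3 i r u) (partial3 j r u).

Definition det_metric (g : metric) (u : R2) : R :=
  g I1 I1 u * g I2 I2 u - g I1 I2 u * g I2 I1 u.

Definition inv_metric (g : metric) : metric :=
  fun i j u =>
    match i, j with
    | I1, I1 => g I2 I2 u / det_metric g u
    | I1, I2 => - g I1 I2 u / det_metric g u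
    | I2, I1 => - g I2 I1 u / det_metric g u
    | I2, I2 => g I1 I1 u / det_metric g u
    end.

(* Gamma^k_{ij} of the Levi-Civita connection. *)
Definition christoffel (g : metric) (k i j : idx) (u : R2) : R :=
  / 2 * sum_idx (fun l => inv_metric g k l u *
    (partial i (g j l) u + partial j (g i l) u - partial l (g i j) u)).

(* The d_l component of R(d_i, d_j) d_k, where
   R(X,Y)Z = nabla_X nabla_Y Z - nabla_Y nabla_X Z - nabla_[X,Y] Z. *)
Definition riemann (g : metric) (l k i j : idx) (u : R2) : R :=
  partial i (christoffel g l j k) u - partial j (christoffel g l i k) u
  + sum_idx (fun m => christoffel g l i m u * christoffel g m j k u
                      - christoffel g l j m u * christoffel g m i k u).

Definition inner (g : metric) (u X Y : R2) : R :=
  sum_idx (fun i => sum_idx (fun j => g i j u * coord i X * coord j Y)).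

Definition curvature_op (g : metric) (u X Y Z : R2) : R2 :=
  let comp l := sum_idx (fun i => sum_idx (fun j => sum_idx (fun k =>
    riemann g l k i j u * coord i X * coord j Y * coord k Z))) in
  (comp I1, comp I2).

Definition sectional_curvature (g : metric) (u X Y : R2) : R :=
  inner g u (curvature_op g u X Y Y) X
  / (inner g u X X * inner g u Y Y - inner g u X Y ^ 2).

Definition basis2 (X Y : R2) : Prop :=
  forall s t : R,
    (forall i, s * coord i X + t * coord i Y = 0) -> s = 0 /\ t = 0.

(* K is the Gauss curvature at p of M with the metric induced from Minkowski
   space: p lies in the image of a local parametrization, and K is the sectional
   curvature at p computed in any local parametrization around p and any basis
   of the tangent plane.  Such a K is unique. *)
Definition gauss_curvature (M : R3 -> Prop) (p : R3) (K : R) : Prop :=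
  (exists (U : R2 -> Prop) (r : R2 -> R3) (u : R2),
     local_param M U r /\ U u /\ r u = p) /\
  (forall (U : R2 -> Prop) (r : R2 -> R3) (u X Y : R2),
     local_param M U r -> U u -> r u = p -> basis2 X Y ->
     K = sectional_curvature (induced_metric r) u X Y).

(* Main.v *)
Require Import Defs.
From Stdlib Require Import Reals Lra.
From Coquelicot Require Import Coquelicot.
Open Scope R_scope.

(* Let n be the Minkowski gradient of half the quadratic form B defining the
   ellipsoid and S = <n, n>.  Differentiating B(r, r) = 1 twice in a local
   parametrization gives <n, r_i> = 0 and <n, r_ij> = - B(r_i, r_j), so the Gauss
   equation reads R_1212 = det B(r_i, r_j) / S.  The Euclidean conormal is m times
   the cross product of r_1 and r_2 for some m <> 0, whence
   m^2 det <r_i, r_j> = - S and m^2 abc det B(r_i, r_j) = 1; the quotient of the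
   two determinants gives K = - 1 / (abc S^2).  If S = 0, then n is a tangent
   vector orthogonal to the tangent plane, so non-degeneracy forces S <> 0.
   Charts around every point come from the two stereographic projections. *)

(** * Partial derivatives *)

(** The coordinate line through u in direction i. It turns both cases of [partial] into one
    derivative along a line, so that the one-variable rules carry over uniformly in i. *)
Definition slice (i : idx) (u : R2) (t : R) : R2 :=
  match i with I1 => (t, snd u) | I2 => (fst u, t) end.

Definition is_partial (i : idx) (f : R2 -> R) (u : R2) (l : R) : Prop :=
  is_derive (fun t => f (slice i u t)) (coord i u) l.

Definition ex_partial (i : idx) (f : R2 -> R) (u : R2) : Prop :=
  ex_derive (fun t => f (slice i u t)) (coord i u).

Lemma slice_coord i u : slice i u (coord i u) = u.
Proof. destruct i, u; reflexivity. Qed.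

Lemma is_partial_unique i f u l : is_partial i f u l -> partial i f u = l.
Proof. intro H; destruct i; exact (is_derive_unique _ _ _ H). Qed.

Lemma partial_correct i f u : ex_partial i f u -> is_partial i f u (partial i f u).
Proof. intro H; destruct i; exact (Derive_correct _ _ H). Qed.

Lemma ex_is_partial i f u l : is_partial i f u l -> ex_partial i f u.
Proof. intro H; exists l; exact H. Qed.

Lemma locally_slice (P : R2 -> Prop) i u :
  locally u P -> locally (coord i u) (fun t => P (slice i u t)).
Proof.
  intros [e He]; exists e; intros t Ht; apply He.
  destruct i, u; split; simpl; try exact Ht; apply ball_center.
Qed.

Lemma is_partial_ext_on (U : R2 -> Prop) i f g u l :
  open U -> U u -> (forall w, U w -> f w = g w) ->
  is_partial i f u l -> is_partial i g u l.
Proof.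
  intros HU Hu E H.
  apply (is_derive_ext_loc (fun t => f (slice i u t))); [|exact H].
  generalize (locally_slice U i u (HU u Hu)); apply filter_imp; auto.
Qed.

Lemma is_partial_const i k u : is_partial i (fun _ => k) u 0.
Proof. exact (is_derive_const k (coord i u)). Qed.

Lemma is_partial_plus i f g u df dg :
  is_partial i f u df -> is_partial i g u dg ->
  is_partial i (fun w => f w + g w) u (df + dg).
Proof. intros Hf Hg; exact (is_derive_plus _ _ _ _ _ Hf Hg). Qed.

Lemma is_partial_minus i f g u df dg :
  is_partial i f u df -> is_partial i g u dg ->
  is_partial i (fun w => f w - g w) u (df - dg).
Proof. intros Hf Hg; exact (is_derive_minus _ _ _ _ _ Hf Hg). Qed.

Lemma is_partial_mult i f g u df dg :
  is_partial i f u df -> is_partial i g u dg ->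
  is_partial i (fun w => f w * g w) u (df * g u + f u * dg).
Proof.
  intros Hf Hg.
  generalize (is_derive_mult _ _ _ _ _ Hf Hg Rmult_comm).
  unfold is_partial; now rewrite slice_coord.
Qed.

Lemma is_partial_scal i k f u df :
  is_partial i f u df -> is_partial i (fun w => k * f w) u (k * df).
Proof. intros Hf; exact (is_derive_scal _ _ _ _ Hf). Qed.

Lemma ex_partial_div i f g u :
  ex_partial i f u -> ex_partial i g u -> g u <> 0 ->
  ex_partial i (fun w => f w / g w) u.
Proof.
  intros Hf Hg H; apply (ex_derive_div _ _ _ Hf Hg); now rewrite slice_coord.
Qed.

(** One partial derivative gives continuity along its coordinate line only. This is enough to
    differentiate, in that direction, an identity valid where a determinant is non-zero. *)
Lemma ex_partial_locally_neq_0 i f u :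
  ex_partial i f u -> f u <> 0 ->
  locally (coord i u) (fun t => f (slice i u t) <> 0).
Proof.
  intros Hf H.
  apply (ex_derive_continuous _ _ Hf (fun v => v <> 0)).
  apply open_neq; now rewrite slice_coord.
Qed.

Lemma smooth_on_ex_partial U f i u : smooth_on U f -> U u -> ex_partial i f u.
Proof.
  intros Hf Hu; destruct (Hf u Hu 1%nat) as (_ & H1 & H2 & _).
  destruct i; assumption.
Qed.

Lemma smooth_on_partial U f i : smooth_on U f -> smooth_on U (partial i f).
Proof.
  intros Hf u Hu n; destruct (Hf u Hu (S n)) as (_ & _ & _ & H1 & H2).
  destruct i; assumption.
Qed.

(** Schwarz's theorem: openness of U gives differentiability around u, and order zero of the
    smoothness of the second partials gives their continuity at u. *)
Lemma partial_comm U f i j u : open U -> smooth_on U f -> U u ->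
  partial i (partial j f) u = partial j (partial i f) u.
Proof.
  intros HU Hf Hu.
  assert (H : partial I1 (partial I2 f) u = partial I2 (partial I1 f) u).
  { destruct u as [u1 u2].
    change (Derive (fun z => Derive (fun t => f (z, t)) u2) u1
      = Derive (fun z => Derive (fun t => f (t, z)) u1) u2).
    apply (Schwarz (fun s t => f (s, t))).
    - apply locally_2d_locally.
      generalize (HU _ Hu); apply filter_imp; intros [s t] Hw.
      repeat split.
      + exact (smooth_on_ex_partial U f I1 _ Hf Hw).
      + exact (smooth_on_ex_partial U f I2 _ Hf Hw).
      + exact (smooth_on_ex_partial U _ I1 _ (smooth_on_partial U f I2 Hf) Hw).
      + exact (smooth_on_ex_partial U _ I2 _ (smooth_on_partial U f I1 Hf) Hw).
    - exact (proj1 (smooth_on_partial _ _ I1 (smooth_on_partial _ _ I2 Hf) _ Hu 0%nat)).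
    - exact (proj1 (smooth_on_partial _ _ I2 (smooth_on_partial _ _ I1 Hf) _ Hu 0%nat)). }
  destruct i, j; auto.
Qed.

(** * Maps into three-space *)

(** One family covers the Euclidean product (1, 1, 1), the Minkowski product (1, 1, -1) and the form
    B of the ellipsoid (inverses of a, b, c). *)
Definition diag_form (p q s : R) (v w : R3) : R :=
  p * (cx v * cx w) + q * (cy v * cy w) + s * (cz v * cz w).

Lemma minkowski_diag_form v w : minkowski v w = diag_form 1 1 (-1) v w.
Proof. unfold minkowski, diag_form; ring. Qed.

Definition smooth_map (U : R2 -> Prop) (r : R2 -> R3) : Prop :=
  smooth_on U (fun u => cx (r u)) /\ smooth_on U (fun u => cy (r u)) /\
  smooth_on U (fun u => cz (r u)).

Lemma local_param_smooth_map M U r : local_param M U r -> smooth_map U r.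
Proof. intros []; repeat split; assumption. Qed.

Lemma smooth_map_partial3 U r i : smooth_map U r -> smooth_map U (partial3 i r).
Proof.
  intros (Hx & Hy & Hz).
  repeat split; now apply (smooth_on_partial U _ i).
Qed.

Lemma partial3_comm U r i j u : open U -> smooth_map U r -> U u ->
  partial3 i (partial3 j r) u = partial3 j (partial3 i r) u.
Proof.
  intros HU (Hx & Hy & Hz) Hu; unfold partial3, cx at 1 3, cy at 1 3, cz at 1 3; simpl.
  f_equal; [f_equal|]; now apply (partial_comm U).
Qed.

Lemma is_partial_diag_form p q s U v w i u :
  smooth_map U v -> smooth_map U w -> U u ->
  is_partial i (fun t => diag_form p q s (v t) (w t)) u
    (diag_form p q s (partial3 i v u) (w u) + diag_form p q s (v u) (partial3 i w u)).
Proof.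
  intros (Vx & Vy & Vz) (Wx & Wy & Wz) Hu.
  assert (P : forall k f g, smooth_on U f -> smooth_on U g ->
    is_partial i (fun t => k * (f t * g t)) u
      (k * (partial i f u * g u + f u * partial i g u))).
  { intros k f g Hf Hg.
    apply is_partial_scal, is_partial_mult; apply partial_correct;
      now apply (smooth_on_ex_partial U). }
  generalize (is_partial_plus _ _ _ _ _ _ (is_partial_plus _ _ _ _ _ _
    (P p _ _ Vx Wx) (P q _ _ Vy Wy)) (P s _ _ Vz Wz)).
  unfold is_partial; intro H; eapply eq_ind; [exact H|].
  unfold diag_form, partial3, cx, cy, cz; simpl; ring.
Qed.

Lemma is_partial_minkowski U v w i u :
  smooth_map U v -> smooth_map U w -> U u ->
  is_partial i (fun t => minkowski (v t) (w t)) u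
    (minkowski (partial3 i v u) (w u) + minkowski (v u) (partial3 i w u)).
Proof.
  intros Hv Hw Hu; rewrite !minkowski_diag_form.
  apply (is_derive_ext (fun t => diag_form 1 1 (-1) (v (slice i u t)) (w (slice i u t)))).
  { intro t; now rewrite minkowski_diag_form. }
  now apply (is_partial_diag_form 1 1 (-1) U).
Qed.

Lemma minkowski_sym v w : minkowski v w = minkowski w v.
Proof. unfold minkowski; ring. Qed.

(** * The Gauss equation *)

Lemma partial_induced_metric U r i j l u : smooth_map U r -> U u ->
  is_partial l (induced_metric r i j) u
    (minkowski (partial3 l (partial3 i r) u) (partial3 j r u)
     + minkowski (partial3 i r u) (partial3 l (partial3 j r) u)).
Proof.
  intros Hr Hu; apply (is_partial_minkowski U); auto; now apply smooth_map_partial3.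
Qed.

(** After commuting second partials, the terms <r_i, r_jl> and <r_j, r_il> cancel and 2 <r_ij, r_l>
    remains. The factors [inv_metric] are carried along unchanged, so the formula holds on all of U
    and can be differentiated. *)
Lemma christoffel_induced_metric U r k i j u : open U -> smooth_map U r -> U u ->
  christoffel (induced_metric r) k i j u =
  sum_idx (fun l => inv_metric (induced_metric r) k l u *
    minkowski (partial3 i (partial3 j r) u) (partial3 l r u)).
Proof.
  intros HU Hr Hu; unfold christoffel, sum_idx.
  rewrite !(is_partial_unique _ _ _ _ (partial_induced_metric U r _ _ _ u Hr Hu)).
  rewrite (partial3_comm U r j i), (partial3_comm U r I1 i), (partial3_comm U r I1 j),
    (partial3_comm U r I2 i), (partial3_comm U r I2 j) by assumption.
  rewrite (minkowski_sym (partial3 i r u)), !(minkowski_sym (partial3 j r u)).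
  field.
Qed.

(** This says that Gamma^l_ij r_l is the tangential part of r_ij. *)
Lemma christoffel_lowered U r i j m u : open U -> smooth_map U r -> U u ->
  det_metric (induced_metric r) u <> 0 ->
  sum_idx (fun l => induced_metric r m l u * christoffel (induced_metric r) l i j u) =
  minkowski (partial3 i (partial3 j r) u) (partial3 m r u).
Proof.
  intros HU Hr Hu Hd; unfold sum_idx.
  rewrite !(christoffel_induced_metric U) by assumption; unfold sum_idx.
  assert (S : induced_metric r I2 I1 u = induced_metric r I1 I2 u)
    by apply minkowski_sym.
  unfold inv_metric; unfold det_metric in *.
  destruct m; rewrite ?S in *; field; exact Hd.
Qed.

Lemma ex_partial_induced_metric U r i j l u : smooth_map U r -> U u ->
  ex_partial l (induced_metric r i j) u.
Proof. intros; eapply ex_is_partial, (partial_induced_metric U); auto. Qed.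

Lemma ex_partial_det_metric U r i u : smooth_map U r -> U u ->
  ex_partial i (det_metric (induced_metric r)) u.
Proof.
  intros Hr Hu.
  eapply ex_is_partial, is_partial_minus; apply is_partial_mult;
    apply partial_correct, (ex_partial_induced_metric U); auto.
Qed.

Lemma ex_partial_christoffel U r k i j l u : open U -> smooth_map U r -> U u ->
  det_metric (induced_metric r) u <> 0 ->
  ex_partial l (christoffel (induced_metric r) k i j) u.
Proof.
  intros HU Hr Hu Hd.
  assert (Hm : forall n m, ex_partial l (inv_metric (induced_metric r) n m) u).
  { intros n m.
    assert (N : forall f, ex_partial l f u -> ex_partial l (fun w => - f w) u).
    { intros f Hf; exact (ex_derive_opp _ _ Hf). }
    pose proof (fun p q => ex_partial_induced_metric U r p q l u Hr Hu) as Hg.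
    pose proof (ex_partial_det_metric U r l u Hr Hu) as Hdet.
    destruct n, m.
    - exact (ex_partial_div l (induced_metric r I2 I2) _ u (Hg _ _) Hdet Hd).
    - exact (ex_partial_div l (fun w => - induced_metric r I1 I2 w) _ u
        (N _ (Hg _ _)) Hdet Hd).
    - exact (ex_partial_div l (fun w => - induced_metric r I2 I1 w) _ u
        (N _ (Hg _ _)) Hdet Hd).
    - exact (ex_partial_div l (induced_metric r I1 I1) _ u (Hg _ _) Hdet Hd). }
  eapply ex_is_partial, (is_partial_ext_on U); [exact HU | exact Hu | | ].
  { intros w Hw; symmetry; now apply (christoffel_induced_metric U). }
  apply is_partial_plus; apply is_partial_mult;
    [apply partial_correct, Hm | | apply partial_correct, Hm | ];
    apply (is_partial_minkowski U); auto; repeat apply smooth_map_partial3; auto.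
Qed.

(** Both sides of [christoffel_lowered] are differentiated by the product rule, so that no
    derivative of the inverse metric has to be computed. *)
Lemma partial_christoffel_lowered U r m i j k u : open U -> smooth_map U r -> U u ->
  det_metric (induced_metric r) u <> 0 ->
  sum_idx (fun l => partial i (induced_metric r m l) u
      * christoffel (induced_metric r) l j k u
    + induced_metric r m l u * partial i (christoffel (induced_metric r) l j k) u) =
  minkowski (partial3 i (partial3 j (partial3 k r)) u) (partial3 m r u)
  + minkowski (partial3 j (partial3 k r) u) (partial3 i (partial3 m r) u).
Proof.
  intros HU Hr Hu Hd.
  pose (L := fun w => sum_idx (fun l => induced_metric r m l w
    * christoffel (induced_metric r) l j k w)).
  transitivity (partial i L u).
  - symmetry; apply is_partial_unique.
    assert (H : forall l, is_partial i (fun w => induced_metric r m l w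
        * christoffel (induced_metric r) l j k w) u
      (partial i (induced_metric r m l) u * christoffel (induced_metric r) l j k u
       + induced_metric r m l u * partial i (christoffel (induced_metric r) l j k) u)).
    { intro l; apply is_partial_mult; apply partial_correct.
      - now apply (ex_partial_induced_metric U).
      - now apply (ex_partial_christoffel U). }
    exact (is_partial_plus i _ _ u _ _ (H I1) (H I2)).
  - apply is_partial_unique.
    apply (is_derive_ext_loc (fun t => minkowski
      (partial3 j (partial3 k r) (slice i u t)) (partial3 m r (slice i u t)))).
    (* Close to u the coordinate line stays in U and the determinant stays non-zero, so
       [christoffel_lowered] applies there. *)
    + generalize (filter_and _ _ (locally_slice U i u (HU u Hu))
        (ex_partial_locally_neq_0 i _ u (ex_partial_det_metric U r i u Hr Hu) Hd)).
      apply filter_imp; intros t [Ht Hdt]; symmetry.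
      now apply (christoffel_lowered U).
    + apply (is_partial_minkowski U); auto; repeat apply smooth_map_partial3; auto.
Qed.

(** The third-order terms <r_ijk, r_m> cancel by symmetry, and the quadratic terms in Gamma cancel
    half of each derivative of the metric. Each remaining bracket pairs the normal part of one
    second derivative with another second derivative. *)
Lemma riemann_lowered U r m k i j u : open U -> smooth_map U r -> U u ->
  det_metric (induced_metric r) u <> 0 ->
  sum_idx (fun l => induced_metric r m l u * riemann (induced_metric r) l k i j u) =
  (minkowski (partial3 j (partial3 k r) u) (partial3 i (partial3 m r) u)
   - sum_idx (fun l => christoffel (induced_metric r) l j k u
       * minkowski (partial3 i (partial3 m r) u) (partial3 l r u)))
  - (minkowski (partial3 i (partial3 k r) u) (partial3 j (partial3 m r) u)
   - sum_idx (fun l => christoffel (induced_metric r) l i k u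
       * minkowski (partial3 j (partial3 m r) u) (partial3 l r u))).
Proof.
  intros HU Hr Hu Hd.
  pose proof (partial_christoffel_lowered U r m i j k u HU Hr Hu Hd) as P1.
  pose proof (partial_christoffel_lowered U r m j i k u HU Hr Hu Hd) as P2.
  pose proof (fun p q => christoffel_lowered U r p q m u HU Hr Hu Hd) as Q.
  rewrite (partial3_comm U (partial3 k r) j i) in P2
    by (try apply smooth_map_partial3; assumption).
  unfold riemann, sum_idx in *.
  rewrite !(is_partial_unique _ _ _ _ (partial_induced_metric U r _ _ _ u Hr Hu)) in P1.
  rewrite !(is_partial_unique _ _ _ _ (partial_induced_metric U r _ _ _ u Hr Hu)) in P2.
  rewrite !(minkowski_sym (partial3 m r u)) in P1, P2.
  set (G := christoffel (induced_metric r)) in *.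
  set (g := induced_metric r) in *.
  (* The quadratic terms are products of a Christoffel symbol with an instance of Q; supplying these
     products makes the goal linear. *)
  pose proof (Rmult_eq_compat_r (G I1 j k u) _ _ (Q i I1)).
  pose proof (Rmult_eq_compat_r (G I2 j k u) _ _ (Q i I2)).
  pose proof (Rmult_eq_compat_r (G I1 i k u) _ _ (Q j I1)).
  pose proof (Rmult_eq_compat_r (G I2 i k u) _ _ (Q j I2)).
  clear Q; lra.
Qed.

(** * Stereographic charts *)

(* An algebra of functions containing the coordinates of the charts and stable
   under differentiation, so that smoothness follows by induction on the order. *)
Inductive stereo_expr : Type :=
  | SConst (k : R)
  | SVar (i : idx)
  | SAdd (e f : stereo_expr)
  | SMul (e f : stereo_expr)
  | SInvDen.

Fixpoint stereo_eval (e : stereo_expr) (u : R2) : R :=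
  match e with
  | SConst k => k
  | SVar i => coord i u
  | SAdd e f => stereo_eval e u + stereo_eval f u
  | SMul e f => stereo_eval e u * stereo_eval f u
  | SInvDen => / (1 + fst u ^ 2 + snd u ^ 2)
  end.

Fixpoint stereo_diff (i : idx) (e : stereo_expr) : stereo_expr :=
  match e with
  | SConst _ => SConst 0
  | SVar j => SConst (match i, j with I1, I1 | I2, I2 => 1 | _, _ => 0 end)
  | SAdd e f => SAdd (stereo_diff i e) (stereo_diff i f)
  | SMul e f => SAdd (SMul (stereo_diff i e) f) (SMul e (stereo_diff i f))
  | SInvDen => SMul (SConst (-2)) (SMul (SVar i) (SMul SInvDen SInvDen))
  end.

Lemma stereo_den_pos s t : 0 < 1 + s ^ 2 + t ^ 2.
Proof. pose proof (pow2_ge_0 s); pose proof (pow2_ge_0 t); lra. Qed.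

Lemma stereo_diff_correct_1 e s t :
  is_derive (fun v => stereo_eval e (v, t)) s (stereo_eval (stereo_diff I1 e) (s, t)).
Proof.
  induction e as [k|[]|e He f Hf|e He f Hf|]; simpl.
  - apply (is_derive_const k s).
  - apply (is_derive_id s).
  - apply (is_derive_const t s).
  - exact (is_derive_plus _ _ _ _ _ He Hf).
  - exact (is_derive_mult _ _ _ _ _ He Hf Rmult_comm).
  - pose proof (stereo_den_pos s t); simpl in *.
    auto_derive; [lra|]. field; lra.
Qed.

Lemma stereo_diff_correct_2 e s t :
  is_derive (fun v => stereo_eval e (s, v)) t (stereo_eval (stereo_diff I2 e) (s, t)).
Proof.
  induction e as [k|[]|e He f Hf|e He f Hf|]; simpl.
  - apply (is_derive_const k t).
  - apply (is_derive_const s t).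
  - apply (is_derive_id t).
  - exact (is_derive_plus _ _ _ _ _ He Hf).
  - exact (is_derive_mult _ _ _ _ _ He Hf Rmult_comm).
  - pose proof (stereo_den_pos s t); simpl in *.
    auto_derive; [lra|]. field; lra.
Qed.

Lemma partial_stereo_eval e i u :
  partial i (stereo_eval e) u = stereo_eval (stereo_diff i e) u.
Proof.
  destruct u, i; apply is_derive_unique;
    [apply stereo_diff_correct_1 | apply stereo_diff_correct_2].
Qed.

Lemma stereo_eval_continuous e s t :
  continuity_2d_pt (fun s t => stereo_eval e (s, t)) s t.
Proof.
  induction e as [k|[]|e He f Hf|e He f Hf|]; simpl.
  - apply continuity_2d_pt_const.
  - apply continuity_2d_pt_id1.
  - apply continuity_2d_pt_id2.
  - now apply continuity_2d_pt_plus.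
  - now apply continuity_2d_pt_mult.
  - apply continuity_2d_pt_inv.
    + repeat first [apply continuity_2d_pt_plus | apply continuity_2d_pt_mult
        | apply continuity_2d_pt_const | apply continuity_2d_pt_id1
        | apply continuity_2d_pt_id2].
    + pose proof (stereo_den_pos s t); simpl in *; lra.
Qed.

Lemma stereo_eval_smooth U e : smooth_on U (stereo_eval e).
Proof.
  intros u _ n; generalize (fst u), (snd u); clear u; revert e.
  induction n as [|n IH]; intros e s t; simpl.
  - split; [apply stereo_eval_continuous | exact I].
  - repeat split.
    + apply stereo_eval_continuous.
    + eexists; apply stereo_diff_correct_1.
    + eexists; apply stereo_diff_correct_2.
    + apply (ex_diff_n_ext_loc (fun s t => stereo_eval (stereo_diff I1 e) (s, t)));
        [|apply IH].
      apply locally_2d_forall; intros v w; symmetry.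
      apply is_derive_unique, stereo_diff_correct_1.
    + apply (ex_diff_n_ext_loc (fun s t => stereo_eval (stereo_diff I2 e) (s, t)));
        [|apply IH].
      apply locally_2d_forall; intros v w; symmetry.
      apply is_derive_unique, stereo_diff_correct_2.
Qed.

(* The inverse of stereographic projection of the unit sphere from (0, 0, s),
   where s = 1 or s = -1, rescaled by the semi-axes A, B, C. *)
Definition stereo (A B C s : R) (u : R2) : R3 :=
  (stereo_eval (SMul (SConst (2 * A)) (SMul (SVar I1) SInvDen)) u,
   stereo_eval (SMul (SConst (2 * B)) (SMul (SVar I2) SInvDen)) u,
   stereo_eval (SMul (SConst (s * C))
     (SAdd (SConst 1) (SMul (SConst (-2)) SInvDen))) u).

Definition stereo_inv (A B C s : R) (p : R3) : R2 :=
  (cx p / A / (1 - s * cz p / C), cy p / B / (1 - s * cz p / C)).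

(** On the chart, [1 - s * cz p / C] equals 2 / (1 + u^2 + v^2). On the ellipsoid this quantity
    vanishes only at the pole of projection, and its positivity describes the image of the chart. *)
Lemma stereo_invK A B C s u : A <> 0 -> B <> 0 -> C <> 0 -> s * s = 1 ->
  0 < 1 - s * cz (stereo A B C s u) / C /\ stereo_inv A B C s (stereo A B C s u) = u.
Proof.
  intros HA HB HC Hs; destruct u as [u v].
  pose proof (stereo_den_pos u v) as HD.
  pose proof (Rinv_0_lt_compat _ HD) as HI.
  assert (E : 1 - s * cz (stereo A B C s (u, v)) / C = 2 * / (1 + u ^ 2 + v ^ 2)).
  { transitivity (1 - s * s * (1 + -2 * / (1 + u ^ 2 + v ^ 2))); [|rewrite Hs; ring].
    unfold cz; simpl in *; field; lra. }
  split; [lra|].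
  unfold stereo_inv; rewrite E; unfold cx, cy; simpl fst; simpl snd.
  f_equal; field; simpl in *; lra.
Qed.

Lemma stereoK A B C s p : A <> 0 -> B <> 0 -> C <> 0 -> s * s = 1 ->
  ellipsoid (A * A) (B * B) (C * C) p -> 1 - s * cz p / C <> 0 ->
  stereo A B C s (stereo_inv A B C s p) = p.
Proof.
  intros HA HB HC Hs HM Hp; destruct p as [[x y] z].
  unfold ellipsoid, cx, cy, cz in *; simpl in HM, Hp.
  unfold stereo, stereo_inv, cx, cy, cz; simpl.
  (* Coordinates on the unit sphere, reflected by s so that the pole of projection is Z = 1 in both
     cases. *)
  set (X := x / A) in *; set (Y := y / B) in *; set (Z := s * z / C) in *.
  assert (Ex : x = A * X) by (unfold X; field; auto).
  assert (Ey : y = B * Y) by (unfold Y; field; auto).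
  assert (Ez : z = s * C * Z)
    by (unfold Z; transitivity (s * s * z); [rewrite Hs; ring | field; auto]).
  assert (E : X * X + Y * Y + Z * Z = 1).
  { rewrite <- HM, Ex, Ey, Ez; clearbody X Y Z.
    transitivity (X * X + Y * Y + s * s * Z * Z); [rewrite Hs; ring | field; auto]. }
  clearbody X Y Z; subst x y z.
  assert (D : 1 + X / (1 - Z) * (X / (1 - Z) * 1) + Y / (1 - Z) * (Y / (1 - Z) * 1)
    = 2 / (1 - Z)).
  { transitivity (((1 - Z) ^ 2 + (X * X + Y * Y)) / (1 - Z) ^ 2); [field; auto|].
    replace (X * X + Y * Y) with (1 - Z * Z) by lra. field; auto. }
  rewrite D; f_equal; [f_equal|]; field; auto.
Qed.

Lemma stereo_ellipsoid A B C s u : A <> 0 -> B <> 0 -> C <> 0 -> s * s = 1 ->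
  ellipsoid (A * A) (B * B) (C * C) (stereo A B C s u).
Proof.
  intros HA HB HC Hs; destruct u as [u v].
  pose proof (stereo_den_pos u v) as HD.
  set (D := 1 + u ^ 2 + v ^ 2) in *.
  change ((2 * A * (u * / D)) ^ 2 / (A * A) + (2 * B * (v * / D)) ^ 2 / (B * B)
    + (s * C * (1 + -2 * / D)) ^ 2 / (C * C) = 1).
  transitivity (4 * (u ^ 2 + v ^ 2) / D ^ 2 + (s * s) * (1 - 2 / D) ^ 2).
  { field; repeat split; auto; lra. }
  rewrite Hs; unfold D in *; field; lra.
Qed.

Lemma continuous_div {T : UniformSpace} (f g : T -> R) (x : T) :
  continuous f x -> continuous g x -> g x <> 0 -> continuous (fun y => f y / g y) x.
Proof.
  intros Hf Hg H; apply (continuous_mult (K := R_AbsRing)); [exact Hf|].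
  apply (continuous_comp g Rinv); [exact Hg | now apply continuous_Rinv].
Qed.

Lemma continuous_cx (p : R3) : continuous cx p.
Proof.
  destruct p as [[x y] z].
  apply (continuous_comp fst fst); apply continuous_fst.
Qed.

Lemma continuous_cy (p : R3) : continuous cy p.
Proof.
  destruct p as [[x y] z].
  apply (continuous_comp fst snd); [apply continuous_fst | apply continuous_snd].
Qed.

Lemma continuous_cz (p : R3) : continuous cz p.
Proof. destruct p as [[x y] z]; apply continuous_snd. Qed.

Lemma stereo_local_param A B C s : A <> 0 -> B <> 0 -> C <> 0 -> s * s = 1 ->
  local_param (ellipsoid (A * A) (B * B) (C * C)) (fun _ => True) (stereo A B C s).
Proof.
  intros HA HB HC Hs.
  pose proof (fun u => stereo_invK A B C s u HA HB HC Hs) as K.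
  assert (HZ : forall p : R3, continuous (fun q => 1 - s * cz q / C) p).
  { intro p; apply (continuous_minus (V := R_NormedModule)); [apply continuous_const|].
    apply continuous_div; [|apply continuous_const|assumption].
    apply (continuous_mult (K := R_AbsRing)); [apply continuous_const | apply continuous_cz]. }
  split.
  - apply open_true.
  - intros u _; now apply stereo_ellipsoid.
  - apply stereo_eval_smooth.
  - apply stereo_eval_smooth.
  - apply stereo_eval_smooth.
  - intros [u v] [X Y] _ E.
    assert (Px : forall i, partial i (fun w => cx (stereo A B C s w)) (u, v) = _)
      by exact (fun i => partial_stereo_eval _ i _).
    assert (Py : forall i, partial i (fun w => cy (stereo A B C s w)) (u, v) = _)
      by exact (fun i => partial_stereo_eval _ i _).
    assert (Pz : forall i, partial i (fun w => cz (stereo A B C s w)) (u, v) = _)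
      by exact (fun i => partial_stereo_eval _ i _).
    unfold Defs.differential, partial3, sum_idx in E; rewrite !Px, !Py, !Pz in E.
    injection E as Ex Ey Ez; clear Px Py Pz.
    unfold cx, cy, cz in Ex, Ey, Ez; simpl in Ex, Ey, Ez.
    pose proof (stereo_den_pos u v) as HD; simpl in HD.
    set (D := 1 + u * (u * 1) + v * (v * 1)) in *.
    assert (HI : / D <> 0) by (apply Rinv_neq_0_compat; lra).
    assert (s <> 0) by (intros ->; lra).
    (* The height depends on D alone, so the third component of the differential gives the vanishing
       of X u + Y v. The other two then reduce to 2 A X / D and 2 B Y / D. *)
    assert (H0 : X * u + Y * v = 0).
    { apply (Rmult_eq_reg_l (4 * s * C * / D * / D)); [lra|].
      repeat apply Rmult_integral_contrapositive_currified; auto; lra. }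
    assert (EX : 2 * A * / D * X = 2 * A * 2 * u * (/ D * / D) * (X * u + Y * v)) by lra.
    assert (EY : 2 * B * / D * Y = 2 * B * 2 * v * (/ D * / D) * (X * u + Y * v)) by lra.
    rewrite H0, Rmult_0_r in EX, EY.
    f_equal.
    + apply (Rmult_eq_reg_l (2 * A * / D)); [lra|].
      repeat apply Rmult_integral_contrapositive_currified; auto; lra.
    + apply (Rmult_eq_reg_l (2 * B * / D)); [lra|].
      repeat apply Rmult_integral_contrapositive_currified; auto; lra.
  - intros u v _ _ E; rewrite <- (proj2 (K u)), E; apply K.
  - intros V HV _.
    (* W is the preimage of V under [stereo_inv] within an open half-space on which [stereo_inv] is
       continuous. *)
    exists (fun p => 0 < 1 - s * cz p / C /\ V (stereo_inv A B C s p)); split.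
    + intros p [Hp Hv].
      assert (Hi : continuous (stereo_inv A B C s) p).
      { assert (H : forall f g : R3 -> R, continuous f p -> continuous g p ->
          continuous (fun q => (f q, g q)) p).
        { intros f g Hf Hg; apply (continuous_comp_2 f g pair); auto.
          apply (continuous_ext (fun w => w)); [now intros []|apply continuous_id]. }
        apply H; (apply continuous_div; [|apply HZ|lra]);
          (apply continuous_div; [|apply continuous_const|assumption]);
          [apply continuous_cx | apply continuous_cy]. }
      apply filter_and.
      * exact (HZ p _ (open_gt 0 _ Hp)).
      * exact (Hi _ (HV _ Hv)).
    + intros p; split.
      * intros (HM & Hp & Hv); exists (stereo_inv A B C s p); split; [exact Hv|].
        apply stereoK; auto; lra.
      * intros (u & Hu & <-); destruct (K u) as [Hp E]; repeat split; auto.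
        -- now apply stereo_ellipsoid.
        -- now rewrite E.
Qed.

Lemma ellipsoid_local_param a b c p : 0 < a -> 0 < b -> 0 < c -> ellipsoid a b c p ->
  exists U r u, local_param (ellipsoid a b c) U r /\ U u /\ r u = p.
Proof.
  intros ha hb hc HM.
  set (A := sqrt a); set (B := sqrt b); set (C := sqrt c).
  assert (HA : A <> 0) by (apply Rgt_not_eq, sqrt_lt_R0; auto).
  assert (HB : B <> 0) by (apply Rgt_not_eq, sqrt_lt_R0; auto).
  assert (HC : C <> 0) by (apply Rgt_not_eq, sqrt_lt_R0; auto).
  rewrite <- (sqrt_sqrt a), <- (sqrt_sqrt b), <- (sqrt_sqrt c) in * by lra.
  fold A B C in HM |- *.
  assert (Hs : exists s, s * s = 1 /\ 1 - s * cz p / C <> 0).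
  (* Projecting from the pole on the opposite side makes [1 - s * cz p / C] at least 1. *)
  { destruct (Rle_dec 0 (cz p / C)); [exists (-1) | exists 1]; split; lra. }
  destruct Hs as (s & Hs & Hp).
  exists (fun _ => True), (stereo A B C s), (stereo_inv A B C s p).
  split; [|split; [exact I|]].
  - now apply stereo_local_param.
  - now apply stereoK.
Qed.

(** * Linear algebra in three-space *)

Definition cross (v w : R3) : R3 :=
  (cy v * cz w - cz v * cy w, cz v * cx w - cx v * cz w, cx v * cy w - cy v * cx w).

Definition lincomb (s t : R) (v w : R3) : R3 :=
  (s * cx v + t * cx w, s * cy v + t * cy w, s * cz v + t * cz w).

Ltac r3_unfold :=
  unfold minkowski, diag_form, cross, lincomb, cx, cy, cz in *; simpl fst in *; simpl snd in *.

Lemma diag_form_1_eq_0 v : diag_form 1 1 1 v v = 0 -> v = (0, 0, 0).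
Proof.
  destruct v as [[x y] z]; r3_unfold; intro H.
  assert (x = 0) by nra; assert (y = 0) by nra; assert (z = 0) by nra; now subst.
Qed.

Lemma cross_independent v w :
  (forall X, lincomb (fst X) (snd X) v w = (0, 0, 0) -> X = (0, 0)) ->
  cross v w <> (0, 0, 0).
Proof.
  intros H E.
  (* The relation (v . w) v - (v . v) w = v x (v x w) = 0 forces v . v = 0, hence v = 0; then (1, 0)
     is a forbidden relation. *)
  assert (H1 : (diag_form 1 1 1 v w, - diag_form 1 1 1 v v) = (0, 0)).
  { apply H; destruct v as [[v1 v2] v3], w as [[w1 w2] w3]; r3_unfold.
    injection E as E1 E2 E3; f_equal; [f_equal|].
    - transitivity (v2 * (v1 * w2 - v2 * w1) - v3 * (v3 * w1 - v1 * w3)); [ring|].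
      rewrite E2, E3; ring.
    - transitivity (v3 * (v2 * w3 - v3 * w2) - v1 * (v1 * w2 - v2 * w1)); [ring|].
      rewrite E1, E3; ring.
    - transitivity (v1 * (v3 * w1 - v1 * w3) - v2 * (v2 * w3 - v3 * w2)); [ring|].
      rewrite E1, E2; ring. }
  injection H1 as _ H1.
  rewrite (diag_form_1_eq_0 v) in H by lra.
  assert (H2 : (1, 0) = (0, 0)).
  { apply H; r3_unfold; f_equal; [f_equal|]; ring. }
  injection H2; lra.
Qed.

(* Because n x (v x w) = (n . w) v - (n . v) w = 0. *)
Lemma orthogonal_cross n v w : cross v w <> (0, 0, 0) ->
  diag_form 1 1 1 n v = 0 -> diag_form 1 1 1 n w = 0 ->
  exists m, n = lincomb m 0 (cross v w) (0, 0, 0).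
Proof.
  intros Hc Hv Hw; set (c := cross v w) in *.
  assert (Hd : diag_form 1 1 1 c c <> 0) by (intro H; now apply Hc, diag_form_1_eq_0).
  exists (diag_form 1 1 1 n c / diag_form 1 1 1 c c).
  assert (E : forall i, i * diag_form 1 1 1 n c / diag_form 1 1 1 c c
    = diag_form 1 1 1 n c / diag_form 1 1 1 c c * i + 0 * 0).
  { intro i; unfold Rdiv; ring. }
  destruct n as [[n1 n2] n3], v as [[v1 v2] v3], w as [[w1 w2] w3].
  unfold lincomb; rewrite <- !E; clear E.
  assert (F : forall i j, i * diag_form 1 1 1 c c = j -> i = j / diag_form 1 1 1 c c).
  { intros i j <-; field; exact Hd. }
  (* E1, E2, E3 are the components of n x c = 0; expanding c x (n x c) = (c . c) n - (n . c) c then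
     yields n. *)
  assert (E3 : n1 * cy c - n2 * cx c = 0).
  { transitivity (v3 * 0 - w3 * 0); [|ring].
    rewrite <- Hv at 2; rewrite <- Hw; unfold c; clear; r3_unfold; ring. }
  assert (E1 : n2 * cz c - n3 * cy c = 0).
  { transitivity (v1 * 0 - w1 * 0); [|ring].
    rewrite <- Hv at 2; rewrite <- Hw; unfold c; clear; r3_unfold; ring. }
  assert (E2 : n3 * cx c - n1 * cz c = 0).
  { transitivity (v2 * 0 - w2 * 0); [|ring].
    rewrite <- Hv at 2; rewrite <- Hw; unfold c; clear; r3_unfold; ring. }
  clearbody c; destruct c as [[c1 c2] c3].
  f_equal; [f_equal|]; apply F; clear F Hd Hc Hv Hw; r3_unfold; apply Rminus_diag_uniq.
  - transitivity (c2 * (n1 * c2 - n2 * c1) - c3 * (n3 * c1 - n1 * c3)); [ring|].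
    rewrite E2, E3; ring.
  - transitivity (c3 * (n2 * c3 - n3 * c2) - c1 * (n1 * c2 - n2 * c1)); [ring|].
    rewrite E1, E3; ring.
  - transitivity (c1 * (n3 * c1 - n1 * c3) - c2 * (n2 * c3 - n3 * c2)); [ring|].
    rewrite E1, E2; ring.
Qed.

(** Cramer's rule: with c = v x w, (c . c) p = ((p x w) . c) v + ((v x p) . c) w + (p . c) c, and
    the last term vanishes. *)
Lemma orthogonal_cross_span p v w : cross v w <> (0, 0, 0) ->
  diag_form 1 1 1 p (cross v w) = 0 -> exists X, p = lincomb (fst X) (snd X) v w.
Proof.
  intros Hc Hp; set (c := cross v w) in *.
  assert (Hd : diag_form 1 1 1 c c <> 0) by (intro H; now apply Hc, diag_form_1_eq_0).
  exists (diag_form 1 1 1 (cross p w) c / diag_form 1 1 1 c c,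
          diag_form 1 1 1 (cross v p) c / diag_form 1 1 1 c c).
  assert (F : forall i j k x y, i * diag_form 1 1 1 c c = j * x + k * y ->
    i = j / diag_form 1 1 1 c c * x + k / diag_form 1 1 1 c c * y).
  { intros i j k x y H; apply (Rmult_eq_reg_r (diag_form 1 1 1 c c)); [|exact Hd].
    rewrite H; field; exact Hd. }
  assert (G : forall i j k, i = j + diag_form 1 1 1 p c * k -> i = j).
  { intros i j k ->; rewrite Hp; ring. }
  destruct p as [[p1 p2] p3], v as [[v1 v2] v3], w as [[w1 w2] w3].
  unfold lincomb; f_equal; [f_equal|]; apply F.
  - apply (G _ _ (cx c)); unfold c; clear; r3_unfold; ring.
  - apply (G _ _ (cy c)); unfold c; clear; r3_unfold; ring.
  - apply (G _ _ (cz c)); unfold c; clear; r3_unfold; ring.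
Qed.

(** * The ellipsoid *)

(* The Minkowski gradient at p of half the quadratic form. *)
Definition normal (a b c : R) (p : R3) : R3 := (cx p / a, cy p / b, - (cz p / c)).

Lemma minkowski_normal a b c p v :
  minkowski (normal a b c p) v = diag_form (/ a) (/ b) (/ c) p v.
Proof. unfold normal, Rdiv; r3_unfold; ring. Qed.

Lemma ellipsoid_diag_form a b c p :
  ellipsoid a b c p <-> diag_form (/ a) (/ b) (/ c) p p = 1.
Proof.
  unfold ellipsoid; r3_unfold.
  split; intro H; rewrite <- H; unfold Rdiv; ring.
Qed.

Lemma local_param_tangent a b c U r i u : local_param (ellipsoid a b c) U r -> U u ->
  diag_form (/ a) (/ b) (/ c) (r u) (partial3 i r u) = 0.
Proof.
  intros Hr Hu; pose proof (local_param_smooth_map _ _ _ Hr) as Hs.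
  pose proof (is_partial_diag_form (/ a) (/ b) (/ c) U r r i u Hs Hs Hu) as H.
  apply is_partial_unique in H.
  rewrite (is_partial_unique i _ u 0) in H.
  - unfold diag_form in *; lra.
  - apply (is_partial_ext_on U i (fun _ => 1)); [apply Hr | exact Hu | |].
    + intros w Hw; symmetry; apply ellipsoid_diag_form, Hr, Hw.
    + apply is_partial_const.
Qed.

Lemma local_param_second_order a b c U r i j u :
  local_param (ellipsoid a b c) U r -> U u ->
  diag_form (/ a) (/ b) (/ c) (r u) (partial3 i (partial3 j r) u)
  = - diag_form (/ a) (/ b) (/ c) (partial3 i r u) (partial3 j r u).
Proof.
  intros Hr Hu; pose proof (local_param_smooth_map _ _ _ Hr) as Hs.
  pose proof (is_partial_diag_form (/ a) (/ b) (/ c) U r (partial3 j r) i u Hs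
    (smooth_map_partial3 _ _ _ Hs) Hu) as H.
  apply is_partial_unique in H.
  rewrite (is_partial_unique i _ u 0) in H.
  - lra.
  - apply (is_partial_ext_on U i (fun _ => 0)); [apply Hr | exact Hu | |].
    + intros w Hw; symmetry; now apply (local_param_tangent a b c U).
    + apply is_partial_const.
Qed.

Lemma differential_lincomb r u X :
  Defs.differential r u X = lincomb (fst X) (snd X) (partial3 I1 r u) (partial3 I2 r u).
Proof. reflexivity. Qed.

Lemma local_param_cross M U r u : local_param M U r -> U u ->
  cross (partial3 I1 r u) (partial3 I2 r u) <> (0, 0, 0).
Proof.
  intros Hr Hu; apply cross_independent; intros X H.
  apply (lp_immersion _ _ _ Hr u X Hu); now rewrite differential_lincomb.
Qed.

Lemma local_param_conormal a b c U r u : local_param (ellipsoid a b c) U r -> U u ->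
  exists m, m <> 0 /\
    (cx (r u) / a, cy (r u) / b, cz (r u) / c)
    = lincomb m 0 (cross (partial3 I1 r u) (partial3 I2 r u)) (0, 0, 0).
Proof.
  intros Hr Hu.
  destruct (orthogonal_cross (cx (r u) / a, cy (r u) / b, cz (r u) / c)
    (partial3 I1 r u) (partial3 I2 r u)) as [m Hm].
  - now apply (local_param_cross (ellipsoid a b c) U).
  - rewrite <- (local_param_tangent a b c U r I1 u Hr Hu); r3_unfold; unfold Rdiv; ring.
  - rewrite <- (local_param_tangent a b c U r I2 u Hr Hu); r3_unfold; unfold Rdiv; ring.
  - exists m; split; [|exact Hm]; intros ->.
    pose proof (proj1 (ellipsoid_diag_form a b c (r u)) (lp_maps _ _ _ Hr u Hu)) as H.
    injection Hm as E1 E2 E3.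
    (* With m = 0 the conormal would vanish, although its Euclidean product with r is B(r, r) =
       1. *)
    assert (H0 : cx (r u) * (cx (r u) / a) + cy (r u) * (cy (r u) / b)
      + cz (r u) * (cz (r u) / c) = 1).
    { rewrite <- H; unfold diag_form, Rdiv; ring. }
    rewrite E1, E2, E3 in H0; lra.
Qed.

(** Its zeros on the ellipsoid are the tropics. *)
Definition normal_sq (a b c : R) (p : R3) : R :=
  cx p ^ 2 / a ^ 2 + cy p ^ 2 / b ^ 2 - cz p ^ 2 / c ^ 2.

Lemma minkowski_normal_normal a b c p : a <> 0 -> b <> 0 -> c <> 0 ->
  minkowski (normal a b c p) (normal a b c p) = normal_sq a b c p.
Proof. intros; unfold normal, normal_sq; r3_unfold; field; auto. Qed.

Lemma nondegenerate_normal_sq a b c p : 0 < a -> 0 < b -> 0 < c -> ellipsoid a b c p ->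
  nondegenerate_at (ellipsoid a b c) p -> normal_sq a b c p <> 0.
Proof.
  intros ha hb hc HM Hnd HS.
  destruct (ellipsoid_local_param a b c p ha hb hc HM) as (U & r & u & Hr & Hu & <-).
  assert (HN : diag_form (/ a) (/ b) (/ c) (r u) (normal a b c (r u)) = 0).
  { rewrite <- minkowski_normal, minkowski_normal_normal by lra; exact HS. }
  assert (H0 : normal a b c (r u) = (0, 0, 0)).
  { apply Hnd.
    - destruct (local_param_conormal a b c U r u Hr Hu) as (m & Hm & E).
      destruct (orthogonal_cross_span (normal a b c (r u)) (partial3 I1 r u)
        (partial3 I2 r u)) as [X HX].
      + now apply (local_param_cross (ellipsoid a b c) U).
      + set (k := cross _ _) in *; clearbody k.
        injection E as E1 E2 E3.
        (* Tangency of n: m times its Euclidean product with r_1 x r_2 is B(r, n) = <n, n> = 0. *)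
        apply (Rmult_eq_reg_l m); [|exact Hm].
        rewrite Rmult_0_r, <- HN.
        set (n := normal a b c (r u)).
        transitivity ((m * cx k + 0 * 0) * cx n + (m * cy k + 0 * 0) * cy n
          + (m * cz k + 0 * 0) * cz n).
        * unfold diag_form; ring.
        * change (cx (0, 0, 0)) with 0 in *; change (cy (0, 0, 0)) with 0 in *;
          change (cz (0, 0, 0)) with 0 in *.
          rewrite <- E1, <- E2, <- E3; unfold diag_form, Rdiv; ring.
      + exists U, r, u, X; repeat split; auto; try apply Hr.
    (* Tangent vectors may come from any chart through the point, so orthogonality is checked in an
       arbitrary chart q. *)
    - intros w (V & q & v & Y & Hq & Hv & Hqv & ->).
      rewrite minkowski_normal, <- Hqv, differential_lincomb.
      pose proof (local_param_tangent a b c V q I1 v Hq Hv) as T1.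
      pose proof (local_param_tangent a b c V q I2 v Hq Hv) as T2.
      transitivity (fst Y * 0 + snd Y * 0); [|ring].
      rewrite <- T1 at 1; rewrite <- T2; r3_unfold; ring. }
  (* But n = 0 contradicts <n, r> = B(r, r) = 1. *)
  pose proof (proj1 (ellipsoid_diag_form a b c (r u)) HM) as H.
  rewrite <- minkowski_normal, H0 in H; r3_unfold; lra.
Qed.

(** By Cauchy-Binet, the Gram determinant of v, w for the diagonal form (p, q, s) is the diagonal
    form (q s, s p, p q) evaluated on v x w. Here m (v x w) is the conormal (x/a, y/b, z/c). *)
Lemma local_param_det_forms a b c U r u : 0 < a -> 0 < b -> 0 < c ->
  local_param (ellipsoid a b c) U r -> U u ->
  exists m, m <> 0 /\
    m ^ 2 * det_metric (induced_metric r) u = - normal_sq a b c (r u) /\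
    m ^ 2 * (a * b * c) *
      (diag_form (/ a) (/ b) (/ c) (partial3 I1 r u) (partial3 I1 r u)
       * diag_form (/ a) (/ b) (/ c) (partial3 I2 r u) (partial3 I2 r u)
       - diag_form (/ a) (/ b) (/ c) (partial3 I1 r u) (partial3 I2 r u) ^ 2) = 1.
Proof.
  intros ha hb hc Hr Hu.
  destruct (local_param_conormal a b c U r u Hr Hu) as (m & Hm & E).
  pose proof (proj1 (ellipsoid_diag_form a b c (r u)) (lp_maps _ _ _ Hr u Hu)) as HM.
  exists m; split; [exact Hm|].
  unfold det_metric, induced_metric, normal_sq.
  destruct (r u) as [[x y] z].
  destruct (partial3 I1 r u) as [[v1 v2] v3], (partial3 I2 r u) as [[w1 w2] w3].
  r3_unfold; injection E as E1 E2 E3.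
  assert (X : x = a * (m * (v2 * w3 - v3 * w2)))
    by (rewrite <- (Rplus_0_r (m * _)), <- (Rmult_0_l 0), <- E1; field; lra).
  assert (Y : y = b * (m * (v3 * w1 - v1 * w3)))
    by (rewrite <- (Rplus_0_r (m * _)), <- (Rmult_0_l 0), <- E2; field; lra).
  assert (Z : z = c * (m * (v1 * w2 - v2 * w1)))
    by (rewrite <- (Rplus_0_r (m * _)), <- (Rmult_0_l 0), <- E3; field; lra).
  clear E1 E2 E3; split; [|rewrite <- HM]; rewrite X, Y, Z; field; lra.
Qed.

(** Inserting the Gauss formula for r_jk and r_ik into [riemann_lowered] removes the tangential
    parts; the normal parts contribute - B_jk <n, r_im> / S = B_jk B_im / S and its counterpart. *)
Lemma gauss_equation a b c U r u m k i j : 0 < a -> 0 < b -> 0 < c ->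
  local_param (ellipsoid a b c) U r -> U u -> normal_sq a b c (r u) <> 0 ->
  sum_idx (fun l => induced_metric r m l u * riemann (induced_metric r) l k i j u) =
  (diag_form (/ a) (/ b) (/ c) (partial3 j r u) (partial3 k r u)
   * diag_form (/ a) (/ b) (/ c) (partial3 i r u) (partial3 m r u)
   - diag_form (/ a) (/ b) (/ c) (partial3 i r u) (partial3 k r u)
     * diag_form (/ a) (/ b) (/ c) (partial3 j r u) (partial3 m r u)) / normal_sq a b c (r u).
Proof.
  intros ha hb hc Hr Hu HS.
  pose proof (local_param_smooth_map _ _ _ Hr) as Hs.
  pose proof (lp_open _ _ _ Hr) as HU.
  destruct (local_param_det_forms a b c U r u ha hb hc Hr Hu) as (l & Hl & Hdet & _).
  assert (Hd : det_metric (induced_metric r) u <> 0) by (intro H; rewrite H in Hdet; lra).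
  rewrite (riemann_lowered U) by assumption.
  set (B := diag_form (/ a) (/ b) (/ c)); set (S := normal_sq a b c (r u)) in *.
  set (n := normal a b c (r u)).
  assert (N : forall p q, minkowski n (partial3 p (partial3 q r) u)
    = - B (partial3 p r u) (partial3 q r u)).
  { intros p q; unfold n; rewrite minkowski_normal.
    now apply (local_param_second_order a b c U). }
  assert (T : forall p, minkowski n (partial3 p r u) = 0).
  { intros p; unfold n; rewrite minkowski_normal.
    now apply (local_param_tangent a b c U). }
  assert (NN : minkowski n n = S) by (apply minkowski_normal_normal; lra).
  (* r_pq = Gamma^l_pq r_l - (B_pq / S) n: both sides have the same product with
     r_1, r_2 and n. *)
  assert (G : forall p q v, minkowski (partial3 p (partial3 q r) u) v
    = christoffel (induced_metric r) I1 p q u * minkowski (partial3 I1 r u) v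
      + christoffel (induced_metric r) I2 p q u * minkowski (partial3 I2 r u) v
      - B (partial3 p r u) (partial3 q r u) / S * minkowski n v).
  { intros p q.
    pose proof (fun s => christoffel_lowered U r p q s u HU Hs Hu Hd) as C.
    pose proof (N p q) as Npq.
    set (f := partial3 p (partial3 q r) u) in *.
    unfold sum_idx, induced_metric at 1 3 in C.
    set (g1 := christoffel (induced_metric r) I1 p q u) in *.
    set (g2 := christoffel (induced_metric r) I2 p q u) in *.
    set (h := B (partial3 p r u) (partial3 q r u) / S) in *.
    (* The difference of the two sides. Orthogonality to r_1 and r_2 makes w a multiple of n, and
       <w, n> = 0 with S non-zero makes that multiple zero. *)
    set (w := lincomb 1 (-1) f (lincomb 1 (- h)
      (lincomb g1 g2 (partial3 I1 r u) (partial3 I2 r u)) n)).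
    assert (W : forall v, minkowski w v = minkowski f v
      - (g1 * minkowski (partial3 I1 r u) v + g2 * minkowski (partial3 I2 r u) v
         - h * minkowski n v)).
    { intro v; unfold w; clear; r3_unfold; ring. }
    assert (W0 : w = (0, 0, 0)).
    { assert (Ws : forall s, minkowski w (partial3 s r u) = 0).
      { intro s; rewrite W, T, <- C, !(minkowski_sym (partial3 s r u)); ring. }
      assert (Wn : minkowski w n = 0).
      { rewrite W, NN, !(minkowski_sym _ n), Npq, !T; unfold h; field; exact HS. }
      destruct (local_param_conormal a b c U r u Hr Hu) as (t & Ht & E).
      (* Flipping the last sign turns Minkowski orthogonality into Euclidean orthogonality. *)
      destruct (orthogonal_cross (cx w, cy w, - cz w) (partial3 I1 r u) (partial3 I2 r u))
        as [d Hc].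
      - now apply (local_param_cross (ellipsoid a b c) U).
      - rewrite <- (Ws I1); clear; r3_unfold; ring.
      - rewrite <- (Ws I2); clear; r3_unfold; ring.
      - assert (Hw : w = lincomb (d / t) 0 n (0, 0, 0)).
        { set (k' := cross _ _) in *; clearbody k' w.
          unfold n, normal; injection E as E1 E2 E3; injection Hc as H1 H2 H3.
          change (cx (0, 0, 0)) with 0 in *; change (cy (0, 0, 0)) with 0 in *;
          change (cz (0, 0, 0)) with 0 in *.
          unfold lincomb; rewrite E1, E2, E3.
          destruct w as [[w1 w2] w3]; unfold cx, cy, cz in H1, H2, H3 |- *.
          simpl fst in *; simpl snd in *.
          f_equal; [f_equal; [rewrite H1|rewrite H2]|
            replace w3 with (- - w3) by ring; rewrite H3]; field; exact Ht. }
        assert (Hdt : d / t = 0).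
        { apply (Rmult_eq_reg_r S); [|exact HS].
          rewrite Rmult_0_l, <- Wn, Hw, <- NN; clear; r3_unfold; ring. }
        rewrite Hw, Hdt; clear; r3_unfold; f_equal; [f_equal|]; ring. }
    intro v; specialize (W v).
    rewrite W0 in W; replace (minkowski (0, 0, 0) v) with 0 in W
      by (clear; r3_unfold; ring).
    lra. }
  rewrite (G j k), (G i k), !N; unfold sum_idx.
  rewrite !(minkowski_sym (partial3 I1 r u)), !(minkowski_sym (partial3 I2 r u)).
  field; exact HS.
Qed.

(** Numerator and denominator are both J^2 times their values on the coordinate basis, where J is
    the determinant of X, Y; the ratio is therefore independent of the basis. *)
Lemma sectional_curvature_ellipsoid a b c U r u X Y : 0 < a -> 0 < b -> 0 < c ->
  local_param (ellipsoid a b c) U r -> U u -> normal_sq a b c (r u) <> 0 -> basis2 X Y ->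
  sectional_curvature (induced_metric r) u X Y = - / (a * b * c * normal_sq a b c (r u) ^ 2).
Proof.
  intros ha hb hc Hr Hu HS HXY.
  pose proof (fun m k i j => gauss_equation a b c U r u m k i j ha hb hc Hr Hu HS) as R.
  destruct (local_param_det_forms a b c U r u ha hb hc Hr Hu) as (l & Hl & Hdet & HB).
  assert (Hd : det_metric (induced_metric r) u <> 0) by (intro H; rewrite H in Hdet; lra).
  set (B := diag_form (/ a) (/ b) (/ c)) in *; set (S := normal_sq a b c (r u)) in *.
  set (det := det_metric (induced_metric r) u) in *.
  set (J := fst X * snd Y - snd X * fst Y).
  assert (HJ : J <> 0).
  { intro H; unfold J in H.
    (* If J = 0, two explicit relations between X and Y force all their coordinates to vanish, and
       then (1, 0) is a relation as well. *)
    assert (H1 : snd Y = 0 /\ - snd X = 0)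
      by (apply HXY; intros []; simpl; lra).
    assert (H2 : - fst Y = 0 /\ fst X = 0)
      by (apply HXY; intros []; simpl; lra).
    assert (H3 : 1 = 0 /\ 0 = 0) by (apply HXY; intros []; simpl; lra).
    lra. }
  assert (Bs : B (partial3 I2 r u) (partial3 I1 r u) = B (partial3 I1 r u) (partial3 I2 r u))
    by (unfold B, diag_form; ring).
  assert (gs : induced_metric r I2 I1 u = induced_metric r I1 I2 u)
    by apply minkowski_sym.
  set (DB := B (partial3 I1 r u) (partial3 I1 r u) * B (partial3 I2 r u) (partial3 I2 r u)
    - B (partial3 I1 r u) (partial3 I2 r u) ^ 2) in *.
  unfold sectional_curvature.
  assert (Num : inner (induced_metric r) u (curvature_op (induced_metric r) u X Y Y) X
    = J ^ 2 * (DB / S)).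
  { transitivity (sum_idx (fun m => sum_idx (fun k => sum_idx (fun i => sum_idx (fun j =>
      sum_idx (fun l => induced_metric r m l u * riemann (induced_metric r) l k i j u)
      * coord i X * coord j Y * coord k Y * coord m X))))).
    - unfold inner, curvature_op, sum_idx; simpl coord; rewrite gs; ring.
    - unfold sum_idx at 1 2 3 4; rewrite !R; unfold sum_idx; rewrite !Bs.
      unfold DB, J, coord; field; exact HS. }
  assert (Den : inner (induced_metric r) u X X * inner (induced_metric r) u Y Y
    - inner (induced_metric r) u X Y ^ 2 = J ^ 2 * det).
  { unfold inner, det, det_metric, sum_idx, J; simpl coord; rewrite gs; ring. }
  rewrite Num, Den.
  (* The conormal factor l enters both determinants as 1 / l^2 and cancels in the quotient. *)
  assert (Edet : det = - S / l ^ 2) by (rewrite <- Hdet; field; exact Hl).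
  assert (EB : DB = / (l ^ 2 * (a * b * c))).
  { apply (Rmult_eq_reg_l (l ^ 2 * (a * b * c))).
    - rewrite HB; field; repeat split; lra.
    - repeat apply Rmult_integral_contrapositive_currified; simpl; lra. }
  rewrite Edet, EB; field; repeat split; auto; lra.
Qed.

Theorem proposition6p1 (a b c : R) (ha : 0 < a) (hb : 0 < b) (hc : 0 < c)
  (hab : a > b) (x y z : R)
  (hM : ellipsoid a b c (x, y, z))
  (hnd : nondegenerate_at (ellipsoid a b c) (x, y, z)) :
  exists K : R,
    gauss_curvature (ellipsoid a b c) (x, y, z) K /\
    K < 0 /\
    1 / K = - (a * b * c) * (x ^ 2 / a ^ 2 + y ^ 2 / b ^ 2 - z ^ 2 / c ^ 2) ^ 2.
Proof.
  pose proof (nondegenerate_normal_sq a b c _ ha hb hc hM hnd) as HS.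
  assert (Habc : 0 < a * b * c) by (repeat apply Rmult_lt_0_compat; assumption).
  pose proof (pow2_gt_0 _ HS) as HS2.
  exists (- / (a * b * c * normal_sq a b c (x, y, z) ^ 2)); split; [split|split].
  - now apply ellipsoid_local_param.
  - intros U r u X Y Hr Hu Hp HXY; rewrite <- Hp in *; symmetry.
    now apply (sectional_curvature_ellipsoid a b c U).
  - apply Ropp_lt_gt_0_contravar, Rinv_0_lt_compat, Rmult_lt_0_compat; assumption.
  - transitivity (- (a * b * c) * normal_sq a b c (x, y, z) ^ 2); [|reflexivity].
    field; repeat split; try exact HS; lra.
Qed.
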